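(* Let $J=\{j_1,\ldots,j_d\}\subset\mathbb{N}$ with $j_1<j_2<\cdots<j_d$, and let $f_1,\ldots,f_m\in\mathbb{R}[X_1,\ldots,X_n]$ be symmetric $J$-sparse polynomials. Let $S=S(f_1,\ldots,f_m)\subset\mathbb{R}^n$ be a non-empty semi-algebraic set described by $f_1,\ldots,f_m$. Then the following holds: (1) If all of $j_1,\ldots,j_d$ are even, then $S$ contains a non-negative point with at most $d$ distinct non-zero coordinates, i.e., $S\cap A_d^+\neq\emptyset$. (2) If at least one of $j_1,\ldots,j_d$ is odd, then $S$ contains a point with at most $\ell:=\min\{j_d,2d+1\}$ distinct coordinates, i.e., $S\cap A_\ell\neq\emptyset$.
   Context: $\mathbb{N}$ denotes the positive integers. A polynomial in $\mathbb{R}[X_1,\ldots,X_n]$ is symmetric if it is invariant under all permutations of the variables. For $i\in\mathbb{N}$ the power sum polynomial is $p_i:=\sum_{j=1}^n X_j^i$. For a set $J=\{j_1,\ldots,j_d\}\subset\mathbb{N}$ of cardinality $d$, a symmetric polynomial $f\in\mathbb{R}[X_1,\ldots,X_n]$ is called $J$-sparse if there is a polynomial $g\in\mathbb{R}[Z_1,\ldots,Z_d]$ with $f=g(p_{j_1},\ldots,p_{j_d})$. A semi-algebraic set is a subset of $\mathbb{R}^n$ defined by a Boolean formula whose atoms are polynomial equalities and inequalities. $S(f_1,\ldots,f_m)\subset\mathbb{R}^n$ denotes a semi-algebraic set such that the equalities and inequalities appearing in its description are given by the polynomials $f_1,\ldots,f_m$ (i.e., each atom compares one of the $f_i$ with $0$).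 For $x=(x_1,\ldots,x_n)\in\mathbb{R}^n$ let $\pi(x):=|\{x_1,\ldots,x_n\}|$ be the number of distinct coordinates of $x$ and $\pi^+(x):=|\{x_1,\ldots,x_n\}\cap\mathbb{R}_{>0}|$ the number of distinct positive coordinates of $x$. For $k\in\mathbb{N}$ set $A_k:=\{x\in\mathbb{R}^n: \pi(x)\le k\}$ and $A_k^+:=\{x\in\mathbb{R}^n_{\ge 0}: \pi^+(x)\le k\}$. *)

(* Defs.v *)
From mathcomp Require Import all_boot all_order all_algebra.
From mathcomp Require Import mpoly.
From mathcomp Require Import classical_sets reals.

Set Implicit Arguments.
Unset Strict Implicit.
Unset Printing Implicit Defensive.

Import Order.TTheory GRing.Theory Num.Theory.

Local Open Scope classical_set_scope.
Local Open Scope ring_scope.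

Definition power_sum (R : realType) (n i : nat) : {mpoly R[n]} :=
  \sum_(j < n) 'X_j ^+ i.

(* A set {j_1 < ... < j_d} of positive integers is given by the increasing
   tuple of its elements. *)
Definition is_index_set (d : nat) (J : d.-tuple nat) : bool :=
  sorted ltn J && all (fun j => 0 < j)%N J.

Definition J_sparse (R : realType) (n d : nat) (J : d.-tuple nat)
    (f : {mpoly R[n]}) : Prop :=
  f \is symmetric /\
  exists g : {mpoly R[d]}, f = g \mPo [tuple power_sum R n (tnth J i) | i < d].

(* Boolean formulas whose atoms compare the i-th of m polynomials with 0. *)
Inductive sa_formula (m : nat) : Type :=
| SaTrue
| SaEq of 'I_m
| SaLe of 'I_m
| SaLt of 'I_m
| SaGe of 'I_m
| SaGt of 'I_m
| SaNot of sa_formula m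
| SaAnd of sa_formula m & sa_formula m
| SaOr of sa_formula m & sa_formula m.

Fixpoint sa_holds (R : realType) (n m : nat) (f : 'I_m -> {mpoly R[n]})
    (x : 'rV[R]_n) (phi : sa_formula m) : bool :=
  match phi with
  | SaTrue => true
  | SaEq i => (f i).@[x ord0] == 0
  | SaLe i => (f i).@[x ord0] <= 0
  | SaLt i => (f i).@[x ord0] < 0
  | SaGe i => 0 <= (f i).@[x ord0]
  | SaGt i => 0 < (f i).@[x ord0]
  | SaNot p => ~~ sa_holds f x p
  | SaAnd p q => sa_holds f x p && sa_holds f x q
  | SaOr p q => sa_holds f x p || sa_holds f x q
  end.

Definition sa_set (R : realType) (n m : nat) (f : 'I_m -> {mpoly R[n]})
    (phi : sa_formula m) : set 'rV[R]_n :=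
  [set x : 'rV[R]_n | sa_holds f x phi].

Definition num_distinct (R : realType) (n : nat) (x : 'rV[R]_n) : nat :=
  size (undup (codom (x ord0))).

Definition num_distinct_pos (R : realType) (n : nat) (x : 'rV[R]_n) : nat :=
  size (undup [seq y <- codom (x ord0) | 0 < y]).

Definition A_ (R : realType) (n k : nat) : set 'rV[R]_n :=
  [set x : 'rV[R]_n | (num_distinct x <= k)%N].

Definition Apos (R : realType) (n k : nat) : set 'rV[R]_n :=
  [set x : 'rV[R]_n | (forall j, 0 <= x ord0 j) /\ (num_distinct_pos x <= k)%N].

(* Main.v *)
Require Import Defs.
From mathcomp Require Import all_boot all_order all_algebra.
From mathcomp Require Import mpoly.
From mathcomp Require Import classical_sets reals.
From mathcomp Require Import topology normedtype derive polyrcf ring lra zify.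

(** Symmetric [J]-sparse polynomials are constant on the fibres of
    [y |-> (p_j(y))], for [j] in [J], so it suffices to find a point with few
    distinct coordinates in the fibre through a given [x] in the set.

    Take an exponent [N] larger than all of [J] such that [rcons J N] contains
    an even exponent.  A bound on an even power sum bounds all coordinates, so
    either the fibre is compact or [p_N] is coercive on it, and [p_N] has a
    minimum on the fibre.  There the gradients of [p_N] and of the [p_j] are
    linearly dependent, which means that all coordinates are roots of one
    nonzero polynomial with exponents [j - 1], for [j] in [rcons J N]
    ([power_sum_multipliers]).  It has at most [d + 1] terms, hence at
    most [d] positive roots ([fewnomial_pos_roots], the weak form of
    Descartes' rule), and so at most [2 d + 1] real roots
    ([fewnomial_roots]).

    If [J] consists of even exponents, [N := j_d + 2] is even and all the
    exponents [j - 1] are odd, so absolute values of coordinates are again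
    roots, and replacing [y] by its coordinatewise absolute value does not
    leave the fibre.  Otherwise [N := j_d + 1] works, because [j_d] or
    [j_d + 1] is even; the polynomial then has degree at most [j_d], which
    bounds the number of distinct coordinates by [j_d] as well.

    Since the gradients of the constraints can be dependent at the minimum,
    the multipliers are those of Fritz John: the objective may get
    coefficient zero.  They come from a penalty argument, free of the implicit
    function theorem: minimisers of [p_N + M * sum_j (p_j - p_j(x))^2] on a
    cube are interior for large [M], hence critical, which yields multipliers
    at points where the constraints nearly hold ([approximate_multipliers]);
    after normalisation, compactness
    gives a point of the fibre and multipliers for it
    ([coord_sum_multipliers]), and this point serves in place of the
    minimum. *)

Set Implicit Arguments.
Unset Strict Implicit.
Unset Printing Implicit Defensive.

Import Order.TTheory GRing.Theory Num.Theory.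
Import numFieldNormedType.Exports.

Local Open Scope classical_set_scope.
Local Open Scope ring_scope.

(** * Real roots of polynomials with few terms *)

Definition fewnomial (R : nzRingType) (c : nat -> R) (E : seq nat) : {poly R} :=
  \sum_(e <- E) c e *: 'X^e.

Lemma horner_fewnomial (R : comNzRingType) (c : nat -> R) (E : seq nat) (t : R) :
  (fewnomial c E).[t] = \sum_(e <- E) c e * t ^+ e.
Proof.
by rewrite horner_sum; apply: eq_bigr => e _; rewrite hornerZ hornerXn.
Qed.

Lemma coef_fewnomial (R : nzRingType) (c : nat -> R) (E : seq nat) (e : nat) :
  uniq E -> e \in E -> (fewnomial c E)`_e = c e.
Proof.
move=> uE eE; rewrite coef_sum (bigD1_seq e) //= coefZ coefXn eqxx mulr1.
rewrite big1 ?addr0 // => e' ne; rewrite coefZ coefXn eq_sym (negbTE ne).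
by rewrite mulr0.
Qed.

Lemma rolle_roots (R : rcfType) (p : {poly R}) (a : R) (s : seq R) :
  path <%R a s -> all (root p) (a :: s) ->
  exists s', [/\ size s' = size s, path <%R a s' & all (root p^`()) s'].
Proof.
elim: s a => [|b s IHs] a /=; first by exists [::].
move=> /andP[ltab pbs] /and3P[/eqP pa0 pb0 ps0].
have [|s' [szs' pbs' rs']] := IHs b pbs; first by rewrite /= pb0.
have [|c] := poly_rolle (p := p) ltab; first by rewrite pa0 (eqP pb0).
rewrite in_itv /= => /andP[ltac ltcb] dpc0; exists (c :: s').
split; rewrite /= ?szs' ?ltac //; last by rewrite rs' andbT; apply/eqP.
by apply: (path_le lt_trans ltcb).
Qed.

(** Induction on the number of terms: dividing by the lowest power of the
    variable leaves the positive roots unchanged and creates a constant term,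
    which differentiation removes, and by Rolle's theorem differentiation
    loses at most one positive root. *)
Lemma fewnomial_pos_roots (R : rcfType) (c : nat -> R) (E : seq nat)
    (s : seq R) :
  sorted ltn E -> has (fun e => c e != 0) E -> uniq s ->
  all (fun t => (0 < t) && root (fewnomial c E) t) s -> (size s < size E)%N.
Proof.
elim: {E}(size E) {-2}E (erefl (size E)) c s => [|n IHn] [|e0 E] //= [szE] c s.
move=> pE hasc us rs.
have ltE e : e \in E -> (e0 < e)%N.
  by move: e; apply/allP; apply: (order_path_min ltn_trans pE).
pose q := (c e0)%:P + \sum_(e <- E) c e *: 'X^(e - e0).
have few_q : fewnomial c (e0 :: E) = 'X^e0 * q.
  rewrite /fewnomial big_cons /q mulrDr [_ * _%:P]mulrC mul_polyC; congr (_ + _).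
  rewrite mulr_sumr big_seq [RHS]big_seq; apply: eq_bigr => e /ltE lte.
  by rewrite -scalerAr -exprD subnKC // ltnW.
have rootq t : t \in s -> (0 < t) && root q t.
  move=> /(allP rs) /andP[t0]; rewrite t0 few_q rootM.
  by rewrite /root hornerXn expf_eq0 (gt_eqF t0) andbF.
have [hasE|nhasE] := boolP (has (fun e => c e != 0) E); last first.
  case: s us rs rootq => // t s _ _ /(_ t (mem_head _ _)) /andP[t0].
  rewrite (negbTE nhasE) orbF in hasc.
  rewrite /root /q hornerD hornerC horner_sum big_seq big1 ?addr0.
    by rewrite (negbTE hasc).
  move=> e eE; rewrite hornerZ; move/hasPn/(_ e eE): nhasE.
  by rewrite negbK => /eqP->; rewrite mul0r.
pose c' f := c (f + e0.+1)%N * f.+1%:R.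
pose E' := [seq (e - e0.+1)%N | e <- E].
have dq : q^`() = fewnomial c' E'.
  rewrite derivD derivC add0r raddf_sum /fewnomial big_map big_seq.
  rewrite [RHS]big_seq; apply: eq_bigr => e /ltE lte.
  rewrite /= derivZ derivXn /c' subnK // subnS prednK ?subn_gt0 //.
  by rewrite mulr_natr -scalerMnl -scalerMnr.
have sE' : sorted ltn E'.
  have /(path_sorted) sE := pE.
  apply: (homo_sorted_in (P := mem E)) sE; last exact/allP.
  by move=> e f /ltE lte /ltE ltf /= ltef; rewrite ltn_sub2rE.
have hasc' : has (fun f => c' f != 0) E'.
  have [e eE ce] := hasP hasE; apply/hasP; exists (e - e0.+1)%N.
    exact: map_f.
  by rewrite /c' subnK ?ltE // mulf_neq0 // pnatr_eq0.
have [E0|] := leqP (size s) 0; first by rewrite (leq_ltn_trans E0).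
have perms : perm_eq (sort <=%R s) s by rewrite perm_sort.
rewrite -(perm_size perms).
have : sorted <%R (sort <=%R s).
  by rewrite lt_sorted_uniq_le sort_uniq us sort_le_sorted.
have: all (fun t => (0 < t) && root q t) (sort <=%R s).
  by apply/allP => t; rewrite (perm_mem perms) => /rootq.
case: (sort _ s) => //= a s1 /andP[/andP[a0 qa] /allP qs1] pas1 _.
have [|s2 [<- pas2 rs2]] := rolle_roots pas1 (p := q).
  by rewrite /= qa; apply/allP => t /qs1 /andP[].
rewrite ltnS (_ : size E = size E'); last by rewrite size_map.
apply: (IHn E' _ c') => //; first by rewrite size_map.
  by have := sorted_uniq lt_trans ltxx (path_sorted pas2).
apply/allP => t ts2; rewrite -dq (allP rs2) // andbT (lt_trans a0) //.
by move: t ts2; apply/allP; apply: (order_path_min lt_trans pas2).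
Qed.

(** The negative roots are positive roots of the polynomial in [- t], which
    has the same exponents; the last root counted is zero. *)
Lemma fewnomial_roots (R : rcfType) (c : nat -> R) (E : seq nat) (s : seq R) :
  sorted ltn E -> has (fun e => c e != 0) E -> uniq s ->
  all (root (fewnomial c E)) s -> (size s <= 2 * (size E).-1 + 1)%N.
Proof.
move=> sE hasc us /allP rs.
have bound c' (s' : seq R) : has (fun e => c' e != 0) E -> uniq s' ->
    all (fun t => (0 < t) && root (fewnomial c' E) t) s' ->
    (size s' <= (size E).-1)%N.
  by move=> h u r; have := fewnomial_pos_roots sE h u r; case: (size E).
pose pos := [seq t <- s | 0 < t]; pose neg := [seq t <- s | t < 0].
have szpos : (size pos <= (size E).-1)%N.
  apply: (bound c) => //; first exact: filter_uniq.
  by apply/allP => t; rewrite mem_filter => /andP[-> /rs].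
have szneg : (size neg <= (size E).-1)%N.
  rewrite -(size_map -%R); apply: (bound (fun e => (-1) ^+ e * c e)).
  - have [e eE ce] := hasP hasc; apply/hasP; exists e => //.
    by rewrite mulf_neq0 // signr_eq0.
  - by rewrite map_inj_uniq ?filter_uniq //; apply: oppr_inj.
  apply/allP => _ /mapP[t + ->]; rewrite mem_filter oppr_gt0 => /andP[-> ts] /=.
  move: (rs t ts); rewrite !rootE !horner_fewnomial => /eqP rt; apply/eqP.
  rewrite -[RHS]rt; apply: eq_bigr => e _; rewrite [(- t) ^+ e]exprNn.
  by rewrite mulrACA -expr2 sqrr_sign mul1r.
have szzero : (size [seq t <- s | t == 0%R] <= 1)%N.
  by rewrite size_filter count_uniq_mem // leq_b1.
have -> : size s = (size pos + size neg + size [seq t <- s | t == 0%R])%N.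
  rewrite !size_filter; elim: (s) => //= t s' ->.
  by case: (ltrgt0P t) => _; lia.
lia.
Qed.

Lemma size_fewnomial (R : nzRingType) (c : nat -> R) (E : seq nat) (N : nat) :
  all (ltn^~ N) E -> (size (fewnomial c E) <= N)%N.
Proof.
move=> /allP ltN; apply/leq_sizeP => j leNj; rewrite coef_sum big_seq big1 // => e eE.
by rewrite coefZ coefXn gtn_eqF ?mulr0 // (leq_trans (ltN e eE)).
Qed.

(** * Lagrange multipliers for sums of univariate polynomials *)

Lemma poly_interior_min (R : realType) (p : {poly R}) (a b c : R) :
  c \in `]a, b[%R -> (forall t, t \in `]a, b[%R -> p.[c] <= p.[t]) ->
  p^`().[c] = 0.
Proof.
move=> cab cmin.
have leab : a <= b by move: cab; rewrite in_itv /= => /andP[/ltW/le_trans le /ltW/le].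
have der0 : is_derive c 1 (horner p) 0.
  by apply: derive1_at_min leab _ cab cmin => t _; apply: derivable_horner.
by rewrite -(@derive_val _ _ _ _ _ _ _ (is_derive_poly p c)) derive_val.
Qed.

Lemma cube_min (R : realType) (n : nat) (F : 'rV[R]_n -> R) (B : R) :
  0 <= B -> continuous F ->
  exists2 y : 'rV[R]_n, (forall i, `|y 0 i| <= B) &
    forall z : 'rV[R]_n, (forall i, `|z 0 i| <= B) -> F y <= F z.
Proof.
move=> B0 cF.
pose A := [set y : 'rV[R]_n | forall i, `[- B, B]%classic (y ord0 i)].
have inA y : (y \in A) <-> (forall i, `|y 0 i| <= B).
  by rewrite inE; split=> yA i; move: (yA i); rewrite /= in_itv /= ler_norml.
have [|||y /inA yB ymin] := @EVT_min_rV R n F A.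
- by exists 0; apply/set_mem/inA => i; rewrite mxE normr0.
- apply: (@rV_compact R n (fun=> `[- B, B]%classic)) => i.
  exact: segment_compact.
- exact: continuous_subspaceT.
by exists y => // z /inA; apply: ymin.
Qed.

(** Restricted to a line parallel to a coordinate axis, such a function is a
    univariate polynomial up to a constant, so criticality can be expressed
    with formal derivatives only. *)
Definition coord_sum (R : realType) (n : nat) (q : {poly R}) (y : 'rV[R]_n) : R :=
  \sum_i q.[y 0 i].

Lemma continuous_add (R : realType) (T : topologicalType) (F G : T -> R) :
  continuous F -> continuous G -> continuous (fun x => F x + G x).
Proof. by move=> cF cG x; apply: cvgD; [apply: cF|apply: cG]. Qed.

Lemma continuous_mul (R : realType) (T : topologicalType) (F G : T -> R) :
  continuous F -> continuous G -> continuous (fun x => F x * G x).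
Proof. by move=> cF cG x; apply: cvgM; [apply: cF|apply: cG]. Qed.

Lemma continuous_sum (R : realType) (T : topologicalType) (I : Type)
    (r : seq I) (P : pred I) (F : I -> T -> R) :
  (forall i, P i -> continuous (F i)) ->
  continuous (fun x => \sum_(i <- r | P i) F i x).
Proof. by move=> cF; apply: continuous_big => //; apply: add_continuous. Qed.

Lemma continuous_sqr (R : realType) (T : topologicalType) (F : T -> R) :
  continuous F -> continuous (fun x => F x ^+ 2).
Proof. by move=> cF; apply: continuous_mul. Qed.

Lemma continuous_horner_comp (R : realType) (T : topologicalType)
    (q : {poly R}) (F : T -> R) :
  continuous F -> continuous (fun x => q.[F x]).
Proof.
by move=> cF x; apply: continuous_comp; [apply: cF|apply: continuous_horner].
Qed.

Lemma continuous_coord_sum (R : realType) (n : nat) (q : {poly R}) :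
  continuous (@coord_sum R n q).
Proof.
by apply: continuous_sum => i _; apply/continuous_horner_comp/coord_continuous.
Qed.

(** The point is a minimiser, over the cube of radius [B], of the objective
    [q k0] plus [M] times the sum of squares of the constraint violations.
    Comparison with [x] shows that for large [M] the violations are small,
    so the boundedness hypothesis puts the minimiser in the interior of the
    cube, where the partial derivatives vanish; the multiplier of [q k] is
    then [2 * M] times the violation. *)
Lemma approximate_multipliers (R : realType) (n d : nat) (q : 'I_d -> {poly R})
    (k0 : 'I_d) (x : 'rV[R]_n) (B eps : R) :
  0 <= B -> 0 < eps ->
  (forall y : 'rV[R]_n, coord_sum (q k0) y <= coord_sum (q k0) x ->
     (forall k, k != k0 -> `|coord_sum (q k) y - coord_sum (q k) x| <= 1) ->
     forall i, `|y 0 i| < B) ->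
  exists (y : 'rV[R]_n) (w : 'I_d -> R),
    [/\ forall i, `|y 0 i| <= B,
        \sum_(k | k != k0) (coord_sum (q k) y - coord_sum (q k) x) ^+ 2 <= eps,
        w k0 = 1 & forall i, \sum_k w k * (q k)^`().[y 0 i] = 0].
Proof.
move=> B0 eps0 bounded.
pose P (y : 'rV[R]_n) := \sum_(k | k != k0) (coord_sum (q k) y - coord_sum (q k) x) ^+ 2.
have P0 y : 0 <= P y by apply: sumr_ge0 => k _; apply: sqr_ge0.
have xB i : `|x 0 i| <= B.
  by apply/ltW/bounded => // k _; rewrite subrr normr0 ler01.
have [y0 _ y0min] := cube_min B0 (@continuous_coord_sum R n (q k0)).
pose e := Num.min eps 1.
have e0 : 0 < e by rewrite lt_min eps0 ltr01.
have [leE le1] : e <= eps /\ e <= 1 by rewrite !ge_min !lexx orbT.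
(* At the minimiser M times the penalty is at most the gap between the value
   of the objective at x and its minimum on the cube. *)
pose gap := coord_sum (q k0) x - coord_sum (q k0) y0.
have gap0 : 0 <= gap by rewrite subr_ge0 y0min.
pose M := gap / e + 1.
have M0 : 0 < M by rewrite ltr_pwDr // divr_ge0 // ltW.
have gapM : gap <= M * e.
  by rewrite mulrDl divfK ?gt_eqF // mul1r lerDl ltW.
have cPhi : continuous (fun y : 'rV[R]_n => coord_sum (q k0) y + M * P y).
  apply: continuous_add; first exact: continuous_coord_sum.
  apply: continuous_mul; first exact: cst_continuous.
  apply: continuous_sum => k _; apply/continuous_sqr/continuous_add.
    exact: continuous_coord_sum.
  exact: cst_continuous.
have [y yB ymin] := cube_min B0 cPhi.
have Px : P x = 0 by apply: big1 => k _; rewrite subrr expr0n.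
have leyx : coord_sum (q k0) y + M * P y <= coord_sum (q k0) x.
  by have := ymin x xB; rewrite Px mulr0 addr0.
have Pe : P y <= e.
  rewrite -(ler_pM2l M0) (le_trans _ gapM) //.
  by have := y0min y yB; rewrite /gap; lra.
have yltB i : `|y 0 i| < B.
  apply: bounded.
    by rewrite (le_trans _ leyx) // lerDl mulr_ge0 // ltW.
  move=> k nk0; rewrite -(@expr_le1 _ 2%N) // real_normK ?num_real //.
  apply: (le_trans _ (le_trans Pe le1)).
  by rewrite /P (bigD1 k) //= lerDl sumr_ge0 // => l _; apply: sqr_ge0.
pose w k := if k == k0 then 1
            else 2 * M * (coord_sum (q k) y - coord_sum (q k) x).
exists y, w; split=> //; [exact: le_trans Pe leE | by rewrite /w eqxx |].
move=> i.
(* The penalised functional along the i-th coordinate line through y. *)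
pose line t : 'rV[R]_n := \row_j (if j == i then t else y 0 j).
pose rest (p : {poly R}) : R := coord_sum p y - p.[y 0 i].
have lineE p t : coord_sum p (line t) = p.[t] + rest p.
  rewrite /rest /coord_sum (bigD1 i) //= mxE eqxx; congr (_ + _).
  rewrite [X in _ = X - _](bigD1 i) //= [X in X - _]addrC addrK.
  by apply: eq_bigr => j ji; rewrite mxE (negbTE ji).
pose r k : {poly R} := q k + (rest (q k) - coord_sum (q k) x)%:P.
pose phi : {poly R} := q k0 + M *: \sum_(k | k != k0) r k ^+ 2.
have phiE t : phi.[t] + rest (q k0) = coord_sum (q k0) (line t) + M * P (line t).
  rewrite lineE /phi hornerD hornerZ horner_sum addrAC; congr (_ + M * _).
  by apply: eq_bigr => k _; rewrite horner_exp hornerD hornerC lineE addrA.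
have line_y : line (y 0 i) = y.
  by apply/rowP => j; rewrite mxE; case: eqP => // ->.
have := @poly_interior_min R phi (- B) B (y 0 i).
rewrite in_itv /= -ltr_norml yltB => /(_ isT) crit.
rewrite -[RHS]crit => [|t tB]; last first.
  rewrite -(lerD2r (rest (q k0))) !phiE line_y; apply: ymin => j.
  rewrite mxE; case: eqP => // _.
  by move: tB; rewrite in_itv /= -ltr_norml => /ltW.
rewrite /phi derivD derivZ raddf_sum hornerD hornerZ horner_sum.
rewrite (bigD1 k0) //= {1}/w eqxx mul1r mulr_sumr; congr (_ + _).
apply: eq_bigr => k /negbTE nk; rewrite /w nk /= deriv_exp.
rewrite derivD derivC addr0 expr1 hornerMn hornerM hornerD hornerC.
rewrite /rest; ring.
Qed.

(** The limit of the approximate multipliers is obtained without extracting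
    subsequences: the conclusion, with unit multiplier vector, says that one
    continuous function of the pair (point, multipliers), a sum of squares,
    vanishes.  It has a minimum on a cube, and the normalised approximate
    solutions make it arbitrarily small there. *)
Lemma coord_sum_multipliers (R : realType) (n d : nat) (q : 'I_d -> {poly R})
    (k0 : 'I_d) (x : 'rV[R]_n) (B : R) :
  1 <= B ->
  (forall y : 'rV[R]_n, coord_sum (q k0) y <= coord_sum (q k0) x ->
     (forall k, k != k0 -> `|coord_sum (q k) y - coord_sum (q k) x| <= 1) ->
     forall i, `|y 0 i| < B) ->
  exists (y : 'rV[R]_n) (w : 'I_d -> R),
    [/\ forall k, k != k0 -> coord_sum (q k) y = coord_sum (q k) x,
        exists k, w k != 0
      & forall i, \sum_k w k * (q k)^`().[y 0 i] = 0].
Proof.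
move=> B1 bounded; have B0 : 0 <= B by apply: le_trans B1.
(* Constraint violation, defect of stationarity and defect of normalisation. *)
pose G (v : 'rV[R]_(n + d)) :=
  \sum_(k | k != k0) (coord_sum (q k) (lsubmx v) - coord_sum (q k) x) ^+ 2.
pose D (v : 'rV[R]_(n + d)) :=
  \sum_i (\sum_k (rsubmx v) 0 k * (q k)^`().[(lsubmx v) 0 i]) ^+ 2.
pose N (v : 'rV[R]_(n + d)) := (\sum_k (rsubmx v) 0 k ^+ 2 - 1) ^+ 2.
have clmx i : continuous (fun v : 'rV[R]_(n + d) => (lsubmx v) 0 i).
  rewrite (_ : (fun v => _) = fun v : 'rV[R]_(n + d) => v 0 (lshift d i)).
    exact: coord_continuous.
  by apply/boolp.funext => v; rewrite mxE.
have crmx k : continuous (fun v : 'rV[R]_(n + d) => (rsubmx v) 0 k).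
  rewrite (_ : (fun v => _) = fun v : 'rV[R]_(n + d) => v 0 (rshift n k)).
    exact: coord_continuous.
  by apply/boolp.funext => v; rewrite mxE.
have cG : continuous G.
  apply: continuous_sum => k _; apply/continuous_sqr/continuous_add.
    by apply: continuous_sum => i _; apply/continuous_horner_comp/clmx.
  exact: cst_continuous.
have cD : continuous D.
  apply: continuous_sum => i _; apply/continuous_sqr/continuous_sum => k _.
  by apply/continuous_mul/continuous_horner_comp/clmx/crmx.
have cN : continuous N.
  apply/continuous_sqr/continuous_add; last exact: cst_continuous.
  by apply: continuous_sum => k _; apply/continuous_sqr/crmx.
have G0 v : 0 <= G v by apply: sumr_ge0 => k _; apply: sqr_ge0.
have D0 v : 0 <= D v by apply: sumr_ge0 => i _; apply: sqr_ge0.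
have N0 v : 0 <= N v by apply: sqr_ge0.
have [v _ vmin] := cube_min B0 (continuous_add (continuous_add cG cD) cN).
have small eps : 0 < eps -> G v + D v + N v <= eps.
  move=> eps0; have [y [w [yB Gy wk0 crit]]] := approximate_multipliers B0 eps0 bounded.
  pose s := Num.sqrt (\sum_k w k ^+ 2).
  have w2ge1 : 1 <= \sum_k w k ^+ 2.
    rewrite (bigD1 k0) //= wk0 expr1n lerDl sumr_ge0 // => k _.
    exact: sqr_ge0.
  have s2 : s ^+ 2 = \sum_k w k ^+ 2.
    by rewrite sqr_sqrtr // (le_trans _ w2ge1).
  have s0 : 0 < s by rewrite sqrtr_gt0 (lt_le_trans _ w2ge1).
  pose u := row_mx y (\row_k (w k / s)).
  have uB i : `|u 0 i| <= B.
    rewrite mxE; case: splitP => k _; first exact: yB.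
    rewrite mxE; apply: le_trans B1.
    rewrite -(@expr_le1 _ 2%N) // real_normK ?num_real // expr_div_n.
    rewrite ler_pdivrMr ?exprn_gt0 // mul1r s2 (bigD1 k) //= lerDl.
    by rewrite sumr_ge0 // => l _; apply: sqr_ge0.
  apply: le_trans (vmin u uB) _.
  rewrite /G /D /N row_mxKl row_mxKr.
  rewrite [X in _ + X + _]big1 ?addr0 => [|i _].
    rewrite (_ : \sum_k _ = 1) ?subrr ?expr0n ?addr0 //.
    under eq_bigr do rewrite mxE expr_div_n.
    by rewrite -mulr_suml -s2 divff // expf_neq0 // gt_eqF.
  under eq_bigr do rewrite mxE mulrAC.
  by rewrite -mulr_suml crit mul0r expr0n.
have le0 : G v + D v + N v <= 0.
  by apply/ler_addgt0Pr => eps /small; rewrite add0r.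
have [Gv Dv Nv] : [/\ G v = 0, D v = 0 & N v = 0].
  have := (G0 v, D0 v, N0 v) => -[[Gv Dv] Nv].
  by split; apply/eqP; rewrite eq_le ?Gv ?Dv ?Nv andbT; lra.
exists (lsubmx v), (fun k => (rsubmx v) 0 k); split.
- move=> k nk; apply/eqP; rewrite -subr_eq0 -sqrf_eq0; apply/eqP.
  by apply: (psumr_eq0P _ Gv) => // l _; apply: sqr_ge0.
- apply/existsP; apply: contraT; rewrite negb_exists => /forallP w0.
  move/eqP: Nv; rewrite sqrf_eq0 big1 ?sub0r ?oppr_eq0 ?oner_eq0 // => k _.
  by have := w0 k; rewrite negbK => /eqP->; rewrite expr0n.
- move=> i; apply/eqP; rewrite -sqrf_eq0; apply/eqP.
  by apply: (psumr_eq0P _ Dv) => // l _; apply: sqr_ge0.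
Qed.

(** * Power sums and sparse polynomials *)

(** The even exponent [e] provides the boundedness needed for multipliers to
    exist: its power sum is either a constraint or the objective. *)
Lemma power_sum_multipliers (R : realType) (n N e : nat) (J : seq nat)
    (x : 'rV[R]_n) :
  sorted ltn (rcons J N) -> all (fun j => 0 < j)%N (rcons J N) ->
  e \in rcons J N -> ~~ odd e ->
  exists (y : 'rV[R]_n) (c : nat -> R),
    [/\ forall j, j \in J -> \sum_i y 0 i ^+ j = \sum_i x 0 i ^+ j,
        has (fun f => c f != 0) (map predn (rcons J N))
      & forall i, root (fewnomial c (map predn (rcons J N))) (y 0 i)].
Proof.
move=> sJ posJ eJ even_e.
have e0 : (0 < e)%N by move/allP: posJ; apply.
pose p j (y : 'rV[R]_n) : R := \sum_i y 0 i ^+ j.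
set J' := rcons J N in sJ posJ eJ *.
pose q (k : 'I_(size J')) : {poly R} := 'X^(tnth (in_tuple J') k).
have qE k y : coord_sum (q k) y = p (tnth (in_tuple J') k) y.
  by apply: eq_bigr => i _; rewrite hornerXn.
have szJ' : (size J < size J')%N by rewrite size_rcons.
pose k0 := Ordinal szJ'.
have k0N : tnth (in_tuple J') k0 = N.
  by rewrite (tnth_nth 0%N) /= nth_rcons ltnn eqxx.
have jk j : j \in J -> exists2 k, k != k0 & tnth (in_tuple J') k = j.
  move=> jJ; have ltj : (index j J < size J)%N by rewrite index_mem.
  exists (Ordinal (ltn_trans ltj szJ')); first by rewrite -val_eqE /= ltn_eqF.
  by rewrite (tnth_nth 0%N) /= nth_rcons ltj nth_index.
pose B := p e x + 2.
have pe_ge0 y : 0 <= p e y.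
  by apply: sumr_ge0 => i _; apply: exprn_even_ge0.
have B1 : 1 <= B by have := pe_ge0 x; rewrite /B; lra.
(* A bound on the even power sum p_e bounds every coordinate. *)
have small y : p e y <= p e x + 1 -> forall i, `|y 0 i| < B.
  move=> pey i; rewrite ltNge; apply/negP => leB.
  have : B <= p e y.
    rewrite /p (bigD1 i) //= -[leLHS]addr0 lerD //; last first.
      by apply: sumr_ge0 => l _; apply: exprn_even_ge0.
    rewrite -[y 0 i ^+ e]ger0_norm ?exprn_even_ge0 // normrX.
    apply: (le_trans leB); apply: ler_eXnr => //.
    exact: le_trans leB.
  by rewrite /B; move: pey; lra.
have [y [w [yx [k wk] crit]]] : exists (y : 'rV[R]_n) (w : 'I_(size J') -> R),
    [/\ forall k, k != k0 -> coord_sum (q k) y = coord_sum (q k) x,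
        exists k, w k != 0
      & forall i, \sum_k w k * (q k)^`().[y 0 i] = 0].
  apply: (coord_sum_multipliers (k0 := k0)) B1 _ => y.
  rewrite !qE k0N => leN close; apply: small.
  move: eJ; rewrite mem_rcons inE => /predU1P[-> | /jk[k nk <-]].
    by rewrite (le_trans leN) // lerDl.
  by have := close k nk; rewrite !qE ler_norml => /andP[_]; lra.
have uJ' : uniq J' by apply: sorted_uniq ltn_trans ltnn _ sJ.
have uE : uniq (map predn J').
  rewrite map_inj_in_uniq // => a b /(allP posJ) a0 /(allP posJ) b0 ab.
  by rewrite -(prednK a0) ab prednK.
pose c f := \sum_(k < size J' | tnth (in_tuple J') k == f.+1) w k * f.+1%:R.
have tpos l : (tnth (in_tuple J') l).-1.+1 = tnth (in_tuple J') l.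
  by rewrite prednK // (allP posJ) // mem_tnth.
have cE l : c (tnth (in_tuple J') l).-1 = w l * (tnth (in_tuple J') l)%:R.
  rewrite /c tpos (big_pred1 l) // => l' /=.
  by apply/eqP/eqP => [|->//]; move/tuple_uniqP: (uJ' : uniq (in_tuple J')); apply.
exists y, c; split.
- by move=> j /jk[k' nk <-]; rewrite -/(p _ y) -!qE yx.
- apply/hasP; exists (tnth (in_tuple J') k).-1; first by rewrite map_f ?mem_tnth.
  by rewrite cE mulf_neq0 // pnatr_eq0 -tpos.
- move=> i; apply/eqP; rewrite horner_fewnomial big_map big_tnth -[RHS](crit i).
  apply: eq_bigr => l _.
  by rewrite cE /q derivXn hornerMn hornerXn -mulrA mulr_natl.
Qed.

Lemma meval_sparse (R : realType) (n d : nat) (J : d.-tuple nat)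
    (f : {mpoly R[n]}) (x y : 'rV[R]_n) :
  J_sparse J f ->
  (forall j, j \in J -> \sum_i y 0 i ^+ j = \sum_i x 0 i ^+ j) ->
  f.@[y ord0] = f.@[x ord0].
Proof.
move=> [_ [g ->]] yx; rewrite !comp_mpoly_meval; apply: mpoly.meval_eq => k.
rewrite !tnth_map tnth_ord_tuple /power_sum !rmorph_sum /=.
under eq_bigr do rewrite rmorphXn /= mevalXU.
by under [RHS]eq_bigr do rewrite rmorphXn /= mevalXU; apply/yx/mem_tnth.
Qed.

Lemma sa_holds_eq (R : realType) (n m : nat) (f : 'I_m -> {mpoly R[n]})
    (x y : 'rV[R]_n) (phi : sa_formula m) :
  (forall i, (f i).@[y ord0] = (f i).@[x ord0]) ->
  sa_holds f y phi = sa_holds f x phi.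
Proof.
by move=> yx; elim: phi => //= [i|i|i|i|i|p ->|p -> q ->|p -> q ->] //; rewrite yx.
Qed.

Lemma sorted_rcons_last (s : seq nat) (N : nat) :
  sorted ltn s -> (last 0%N s < N)%N -> sorted ltn (rcons s N).
Proof. by case: s => //= a s sas ltN; rewrite rcons_path sas. Qed.

Lemma lt_sorted_rcons (s : seq nat) (N j : nat) :
  sorted ltn (rcons s N) -> j \in s -> (j < N)%N.
Proof.
rewrite sorted_pairwise; last exact: ltn_trans.
by rewrite pairwise_rcons => /andP[/allP ltN _] /ltN.
Qed.

Lemma sorted_predn (s : seq nat) :
  sorted ltn s -> all (fun j => 0 < j)%N s -> sorted ltn (map predn s).
Proof.
move=> ss pos; apply: (homo_sorted_in _ pos) ss => j k; rewrite !unfold_in.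
lia.
Qed.

Theorem theorem2p6 (R : realType) (n m d : nat) (J : d.-tuple nat)
    (hJ : is_index_set J)
    (f : 'I_m -> {mpoly R[n]}) (hf : forall i, J_sparse J (f i))
    (phi : sa_formula m) (hS : sa_set f phi !=set0) :
  (all (fun j => ~~ odd j) J -> sa_set f phi `&` Apos d !=set0) /\
  (has odd J ->
     sa_set f phi `&` A_ (minn (last 0%N J) (2 * d + 1)) !=set0).
Proof.
have [x xS] := hS; have [sJ posJ] := andP hJ.
pose N0 := last 0%N J.
have N0J : N0 \in 0%N :: J by apply: mem_last.
have stays (y : 'rV[R]_n) :
    (forall j, j \in J -> \sum_i y 0 i ^+ j = \sum_i x 0 i ^+ j) ->
    sa_set f phi y.
  move=> yx; rewrite /sa_set /= (@sa_holds_eq _ _ _ _ x) // => i.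
  exact: meval_sparse (hf i) yx.
have posN N : (0 < N)%N -> all (fun j => 0 < j)%N (rcons J N).
  by move=> N_gt0; rewrite all_rcons N_gt0.
have sizeE N : size (map predn (rcons J N)) = d.+1.
  by rewrite size_map size_rcons size_tuple.
split=> [/allP evenJ | /hasP[o oJ odd_o]].
- pose N := N0.+2.
  have sN : sorted ltn (rcons J N) by apply: sorted_rcons_last.
  have evenN : ~~ odd N.
    by rewrite /N /= negbK; case/predU1P: N0J => [->|/evenJ].
  have NJ : N \in rcons J N by rewrite mem_rcons mem_head.
  have [y [c [yx hasc rooty]]] :=
    power_sum_multipliers x sN (posN N isT) NJ evenN.
  pose E := map predn (rcons J N).
  (* All exponents are odd, so the roots are symmetric about zero. *)
  have oddE e : e \in E -> odd e.
    case/mapP=> j; rewrite mem_rcons inE => /predU1P[->|jJ] -> //=.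
      by move: evenN; rewrite /= negbK.
    by have := allP posJ j jJ; have := evenJ j jJ; case: (j) => //= k; rewrite negbK.
  have root_abs i : root (fewnomial c E) `|y 0 i|.
    have [_|_] := ger0P (y 0 i); first exact: rooty.
    have /eqP := rooty i; rewrite rootE !horner_fewnomial => yi.
    rewrite -oppr_eq0 -[X in _ == X]yi -sumrN !big_seq; apply/eqP.
    by apply: eq_bigr => e /oddE oe; rewrite exprNn -signr_odd oe mulN1r mulrN opprK.
  exists (map_mx Num.norm y); split.
    apply: stays => j jJ; rewrite -(yx j jJ); apply: eq_bigr => i _.
    by rewrite mxE -normrX ger0_norm // exprn_even_ge0 // evenJ.
  split=> [j|]; first by rewrite mxE.
  rewrite -ltnS -(sizeE N) /num_distinct_pos.
  apply: fewnomial_pos_roots _ hasc (undup_uniq _) _.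
    exact: sorted_predn (posN _ _).
  apply/allP => t; rewrite mem_undup mem_filter => /andP[-> /codomP[i ->]].
  by rewrite mxE root_abs.
- pose N := N0.+1.
  have sN : sorted ltn (rcons J N) by apply: sorted_rcons_last.
  have N0J' : N0 \in J.
    case/predU1P: N0J => // N00; have := lt_sorted_rcons sN oJ.
    by rewrite /N N00; case: (o) odd_o.
  have [e eJ even_e] : exists2 e, e \in rcons J N & ~~ odd e.
    have [oddN0|evenN0] := boolP (odd N0).
      by exists N; rewrite ?mem_rcons ?mem_head //= negbK.
    by exists N0; rewrite // mem_rcons inE N0J' orbT.
  have [y [c [yx hasc rooty]]] :=
    power_sum_multipliers x sN (posN N isT) eJ even_e.
  pose E := map predn (rcons J N).
  have sE : sorted ltn E by apply: sorted_predn (posN _ _).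
  have rs : all (root (fewnomial c E)) (undup (codom (y ord0))).
    by apply/allP => t; rewrite mem_undup => /codomP[i ->].
  exists y; split; first exact: stays.
  rewrite /A_ /= leq_min /num_distinct; apply/andP; split; last first.
    by have := fewnomial_roots sE hasc (undup_uniq _) rs; rewrite sizeE.
  rewrite -ltnS -/N0 -/N; apply: (@leq_trans (size (fewnomial c E))).
    apply: max_poly_roots rs (undup_uniq _).
    apply/eqP => few0; have [k kE /eqP[]] := hasP hasc.
    rewrite -(coef_fewnomial c _ kE) ?few0 ?coef0 //.
    exact: sorted_uniq ltn_trans ltnn _ sE.
  apply: size_fewnomial; apply/allP => _ /mapP[j jJ ->] /=.
  move: jJ; rewrite mem_rcons inE => /predU1P[->//|jJ].
  exact: leq_ltn_trans (leq_pred j) (lt_sorted_rcons sN jJ).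
Qed.
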